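(* Let $(\mathfrak{g},[-,-],\omega)$ be a finite-dimensional nontrivial $\omega$-Lie algebra over $\mathbb{C}$ and let $V$ be a finite-dimensional $\mathfrak{g}$-module. On the direct sum of vector spaces $\mathfrak{g}\oplus V$ define a skew-symmetric bilinear bracket by $$[(x,v),(y,u)]:=([x,y],\,x\cdot u-y\cdot v)$$ and a bilinear form $\Omega:(\mathfrak{g}\oplus V)\times(\mathfrak{g}\oplus V)\to\mathbb{C}$ by $$\Omega((x,v),(y,u)):=\omega(x,y)$$ for all $x,y\in\mathfrak{g}$ and $u,v\in V$. Then $(\mathfrak{g}\oplus V,[-,-],\Omega)$ is an $\Omega$-Lie algebra.
   Context: An $\omega$-Lie algebra over $\mathbb{C}$ is a triple $(\mathfrak{g},[-,-],\omega)$ where $\mathfrak{g}$ is a finite-dimensional complex vector space, $[-,-]$ is a skew-symmetric bilinear bracket on $\mathfrak{g}$ and $\omega:\mathfrak{g}\times\mathfrak{g}\to\mathbb{C}$ is a bilinear form (necessarily skew-symmetric in the nontrivial case) such that $$[[x,y],z]+[[y,z],x]+[[z,x],y]=\omega(x,y)z+\omega(y,z)x+\omega(z,x)y$$ for all $x,y,z\in\mathfrak{g}$. It is called nontrivial if $(\mathfrak{g},[-,-])$ is not a Lie algebra. An $\Omega$-Lie algebra is the same notion with the form denoted $\Omega$. A finite-dimensional complex vector space $V$ is a $\mathfrak{g}$-module if there is a bilinear map $\mathfrak{g}\times V\to V$, $(x,v)\mapsto x\cdot v$, such that $$[x,y]\cdot v=x\cdot(y\cdot v)-y\cdot(x\cdot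 v)+\omega(x,y)v$$ for all $x,y\in\mathfrak{g}$ and $v\in V$. *)

(* Defs.v *)
From mathcomp Require Import all_boot all_order all_algebra.
From mathcomp Require Import reals complex.

Set Implicit Arguments.
Unset Strict Implicit.
Unset Printing Implicit Defensive.

Import GRing.Theory.
Local Open Scope ring_scope.

Section OmegaLie.
Variable C : fieldType.

Implicit Types g V : vectType C.

Definition cyclic_sum g (br : g -> g -> g) (x y z : g) : g :=
  br (br x y) z + br (br y z) x + br (br z x) y.

Record is_lie g (br : g -> g -> g) : Prop := IsLie {
  lie_bilinear : bilinear_for *:%R *:%R br;
  lie_skew : forall x y, br x y = - br y x;
  lie_jacobi : forall x y z, cyclic_sum br x y z = 0 }.

(* The form is only required to be bilinear: skew-symmetry of [omega] is not
   part of the definition, but follows from it when [br] is not a Lie bracket. *)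
Record is_omega_lie g (br : g -> g -> g) (omega : g -> g -> C) : Prop :=
  IsOmegaLie {
    omega_lie_bilinear : bilinear_for *:%R *:%R br;
    omega_lie_skew : forall x y, br x y = - br y x;
    omega_form_bilinear : bilinear_for *%R *%R omega;
    omega_jacobi : forall x y z,
      cyclic_sum br x y z = omega x y *: z + omega y z *: x + omega z x *: y }.

Definition nontrivial_omega_lie g (br : g -> g -> g) (omega : g -> g -> C) :
  Prop := is_omega_lie br omega /\ ~ is_lie br.

Record is_omega_module g (br : g -> g -> g) (omega : g -> g -> C)
    V (act : g -> V -> V) : Prop := IsOmegaModule {
  act_bilinear : bilinear_for *:%R *:%R act;
  act_bracket : forall x y v,
    act (br x y) v = act x (act y v) - act y (act x v) + omega x y *: v }.

Definition sum_bracket g V (br : g -> g -> g) (act : g -> V -> V)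
    (p q : g * V) : g * V :=
  (br p.1 q.1, act p.1 q.2 - act q.1 p.2).

Definition sum_form g V (omega : g -> g -> C) (p q : g * V) : C :=
  omega p.1 q.1.

End OmegaLie.

(* Main.v *)
Require Import Defs.
From mathcomp Require Import all_boot all_order all_algebra.
From mathcomp Require Import reals complex.

Import GRing.Theory.
Local Open Scope ring_scope.

(** Every identity to be checked splits into a component in [g], where it is the
    corresponding identity of [g] itself, and a component in [V], so only the
    latter is at stake.  On [(x, v)], [(y, u)], [(z, w)] the [V]-component of
    the cyclic sum consists of
      [[x, y].w - z.(x.u - y.v)]
    and its two cyclic images.  The module axiom turns [[x, y].w] into
    [x.(y.w) - y.(x.w) + omega x y *: w].  Over the three images, each of the
    six double actions then occurs twice, with opposite signs
    ([double_actions_cancel]), and what survives is the cyclic sum of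
    [omega x y *: w], the [V]-component of the right-hand side
    ([sum_bracket_jacobi]). *)

(** Here [xyw] stands for [x.(y.w)] and so on, while [a], [b], [c] are the
    correction terms contributed by the module axiom. *)
Lemma double_actions_cancel (V : zmodType) (xyw yxw zxu zyv yzv xzu a b c : V) :
  (xyw - yxw + a - (zxu - zyv)) + (yzv - zyv + b - (xyw - xzu))
    + (zxu - xzu + c - (yzv - yxw)) = a + b + c.
Proof.
rewrite !opprB !addrA.
(* Put opposite double actions next to each other, corrections last. *)
rewrite [LHS](ACl (1*10*2*14*4*7*5*11*6*15*9*12*3*8*13)) /=.
by rewrite !(subrr, add0r, addNr).
Qed.

Section SemidirectSum.
Variables (C : fieldType) (g V : vectType C).
Variables (br : g -> g -> g) (omega : g -> g -> C) (act : g -> V -> V).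

Lemma sum_bracket_bilinear :
  bilinear_for *:%R *:%R br -> bilinear_for *:%R *:%R act ->
  bilinear_for (U := (g * V)%type) (U' := (g * V)%type) (V := (g * V)%type)
    *:%R *:%R (sum_bracket br act).
Proof.
case=> brl brr [actl actr]; split=> p a q r; congr pair => /=.
- exact: brl.
- by rewrite actl actr scalerBr opprD addrACA.
- exact: brr.
- by rewrite actl actr scalerBr opprD addrACA.
Qed.

Lemma sum_bracket_skew :
  (forall x y, br x y = - br y x) ->
  forall p q, sum_bracket br act p q = - sum_bracket br act q p.
Proof. by move=> brC p q; congr pair; [exact: brC | rewrite opprB]. Qed.

Lemma sum_form_bilinear :
  bilinear_for *%R *%R omega ->
  bilinear_for (U := (g * V)%type) (U' := (g * V)%type) *%R *%R
    (sum_form (V := V) omega).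
Proof. by case=> oml omr; split=> p a q r; [exact: oml | exact: omr]. Qed.

(** In the [V]-component, the double actions produced by the module axiom are
    cancelled by those produced by bracketing with the third argument. *)
Lemma sum_bracket_jacobi :
  (forall x y z, cyclic_sum br x y z =
     omega x y *: z + omega y z *: x + omega z x *: y) ->
  is_omega_module br omega act ->
  forall p q r : g * V, cyclic_sum (g := (g * V)%type) (sum_bracket br act) p q r =
     sum_form omega p q *: r + sum_form omega q r *: p + sum_form omega r p *: q.
Proof.
move=> jacobi [[_ actr] act_br] [x v] [y u] [z w]; congr pair => /=.
  exact: jacobi.
have actB t v1 v2 : act t (v1 - v2) = act t v1 - act t v2.
  by rewrite [v1 - v2]addrC -scaleN1r actr /= scaleN1r addrC.
by rewrite !act_br !actB double_actions_cancel.
Qed.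

End SemidirectSum.

Theorem proposition6p2 (R : realType) (g : vectType R[i])
    (br : g -> g -> g) (omega : g -> g -> R[i])
    (hg : nontrivial_omega_lie br omega)
    (V : vectType R[i]) (act : g -> V -> V)
    (hV : is_omega_module br omega act) :
  is_omega_lie (g := (g * V)%type) (sum_bracket br act) (sum_form omega).
Proof.
case: hg => -[br_bilin br_skew om_bilin jacobi] _; split.
- exact: sum_bracket_bilinear br_bilin (act_bilinear hV).
- exact: sum_bracket_skew.
- exact: sum_form_bilinear.
- exact: sum_bracket_jacobi.
Qed.
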